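(* Let $d\ge 2$ and let $\mathcal{A}=\{\alpha_1,\dots,\alpha_n\}\subset\mathbb{R}^d$ be an irreducible Euclidean $\vee$-system. Let $\Delta_{\mathcal{A}}=\{\Delta_1,\dots,\Delta_n\}$ be the arrangement of hyperplanes $\Delta_i=\alpha_i^{\perp}$ and let $r_{\mathcal{A}}=(r_1,\dots,r_n)$ with $r_i=|\alpha_i|^2$. Then $(\Delta_{\mathcal{A}},r_{\mathcal{A}})$ is a real PK arrangement in $\mathbb{R}^d$.
   Context: $\mathbb{R}^d$ carries its standard Euclidean inner product $(\cdot,\cdot)$. Euclidean $\vee$-system in $\mathbb{R}^d$: a finite set $\mathcal{A}=\{\alpha_1,\dots,\alpha_n\}\subset\mathbb{R}^d\setminus\{0\}$ of pairwise non-proportional vectors such that: (V1) $\sum_{i=1}^n (x,\alpha_i)^2=|x|^2$ for all $x\in\mathbb{R}^d$; (V2) for every linear $2$-plane $\Pi\subset\mathbb{R}^d$ with $|\mathcal{A}\cap\Pi|\ge 3$ there is $\nu(\Pi)\in\mathbb{R}$ with $\sum_{i:\alpha_i\in\Pi}(x,\alpha_i)^2=\nu(\Pi)|x|^2$ for all $x\in\Pi$; (V3) for every linear $2$-plane $\Pi$ with $\mathcal{A}\cap\Pi=\{\alpha_i,\alpha_j\}$, $i\ne j$, one has $(\alpha_i,\alpha_j)=0$. $\mathcal{A}$ is reducible if there is a non-trivial direct sum decomposition $\mathbb{R}^d=P\oplus P'$ into linear subspaces with $\mathcal{A}=(\mathcal{A}\cap P)\cup(\mathcal{A}\cap P')$;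 it is irreducible if it is not reducible. Hirzebruch quadratic form: for a finite set $\mathcal{H}=\{H_1,\dots,H_n\}$ of pairwise distinct linear hyperplanes in $\mathbb{R}^d$, let $\mathcal{G}$ be the set of codimension-$2$ linear subspaces $S$ that are the common intersection of $3$ or more hyperplanes in $\mathcal{H}$; let $w_S=\frac12\sum_{i:S\subset H_i}w_i$ for $S\in\mathcal{G}$; and let $\sigma_i$ be the number of $S\in\mathcal{G}$ with $S\subset H_i$. The Hirzebruch quadratic form of $\mathcal{H}$ is $$Q(w_1,\dots,w_n)=\sum_{S\in\mathcal{G}}w_S^2-\frac12\sum_{i=1}^n(\sigma_i-1)w_i^2-\frac1{2d}\Big(\sum_{i=1}^n w_i\Big)^2 .$$ Real PK arrangement in $\mathbb{R}^d$ ($d\ge2$): a pair $(\mathcal{H},w)$ with $\mathcal{H}=\{H_1,\dots,H_n\}$ a finite set of pairwise distinct linear hyperplanes and $w\in(0,1)^n$ such that: (PK1) $\sum_i w_i=d$; (PK2) for every non-zero proper linear subspace $L\subset\mathbb{R}^d$ that is an intersection of hyperplanes in $\mathcal{H}$, $\sum_{i:L\subset H_i}w_i<d-\dim L$; (PK3) $Q(w)=0$, where $Q$ is the Hirzebruch quadratic form of $\mathcal{H}$. *)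

(* Defs.v *)
From mathcomp Require Import all_boot all_order all_algebra.
From mathcomp Require Import reals.

Set Implicit Arguments.
Unset Strict Implicit.
Unset Printing Implicit Defensive.

Import Order.TTheory GRing.Theory Num.Theory.
Local Open Scope ring_scope.

(* Finite sets of vectors and of hyperplanes are injective families indexed by
   'I_n, so that weights can be indexed by 'I_n as well. *)

Section Defs.
Variables (R : realType) (d : nat).
Local Notation V := 'rV[R]_d.

Definition dot (x y : V) : R := \sum_(k < d) x 0 k * y 0 k.

Definition sqnorm (x : V) : R := dot x x.

(* Kernel of the linear map x |-> x *m a^T = (x, a); see mem_orthv. *)
Definition orthv (a : V) : {vspace V} := lker (linfun (mulmxr a^T : V -> 'M[R]_1)).

Lemma mem_orthv (a x : V) : (x \in orthv a) = (dot x a == 0).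
Proof.
rewrite memv_ker lfunE /=.
have -> : x *m a^T = (dot x a)%:M.
  apply/matrixP => i j; rewrite !ord1 !mxE mulr1n.
  by apply: eq_bigr => k _; rewrite mxE.
apply/eqP/eqP => [/matrixP/(_ 0 0)|->]; first by rewrite !mxE mulr1n.
by apply/matrixP => i j; rewrite !mxE mul0rn.
Qed.

Section VeeSystems.
Variables (n : nat) (alpha : 'I_n -> V).

(* In vee_V2 and vee_V3 the subset of 'I_n represents the intersection of the
   system with the plane Pi, the family being injective by vee_nonprop. *)
Record euclidean_vee_system : Prop := EuclideanVeeSystem {
  vee_neq0 : forall i, alpha i != 0;
  vee_nonprop : forall i j, i != j -> forall c : R, alpha i <> c *: alpha j;
  vee_V1 : forall x : V, \sum_i dot x (alpha i) ^+ 2 = sqnorm x;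
  vee_V2 : forall Pi : {vspace V}, \dim Pi = 2%N ->
    (3 <= #|[set i | alpha i \in Pi]|)%N ->
    exists nu : R, forall x : V, x \in Pi ->
      \sum_(i | alpha i \in Pi) dot x (alpha i) ^+ 2 = nu * sqnorm x;
  vee_V3 : forall Pi : {vspace V}, \dim Pi = 2%N ->
    forall i j, i != j -> [set k | alpha k \in Pi] = [set i; j] ->
      dot (alpha i) (alpha j) = 0
}.

Definition reducible_system : Prop :=
  exists P P' : {vspace V},
    [/\ P != 0%VS, P' != 0%VS,
        (P + P')%VS = fullv, (P :&: P')%VS = 0%VS
      & forall i, (alpha i \in P) || (alpha i \in P')].

Definition irreducible_system : Prop := ~ reducible_system.

End VeeSystems.

Section Arrangements.
Variables (n : nat) (H : 'I_n -> {vspace V}).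

Record hyperplane_arrangement : Prop := HyperplaneArrangement {
  arr_hyperplane : forall i, (\dim (H i)).+1 = d;
  arr_inj : injective H
}.

Definition codim2_strata : seq {vspace V} :=
  undup [seq S <- [seq (\bigcap_(i in J) H i)%VS
                  | J : {set 'I_n} in [pred J : {set 'I_n} | 3 <= #|J|]%N]
        | (\dim S).+2 == d].

Lemma mem_codim2_strata (S : {vspace V}) :
  S \in codim2_strata <->
  (\dim S).+2 = d /\
  exists2 J : {set 'I_n}, (3 <= #|J|)%N & S = (\bigcap_(i in J) H i)%VS.
Proof.
rewrite mem_undup mem_filter; split.
  by case/andP=> /eqP dS /imageP[J J3 defS]; split=> //; exists J.
by case=> dS [J J3 defS]; rewrite dS eqxx; apply/imageP; exists J.
Qed.

Definition stratum_weight (w : 'I_n -> R) (S : {vspace V}) : R :=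
  2^-1 * \sum_(i | (S <= H i)%VS) w i.

Definition sigma (i : 'I_n) : nat :=
  count (fun S : {vspace V} => (S <= H i)%VS) codim2_strata.

Definition hirzebruch_form (w : 'I_n -> R) : R :=
  \sum_(S <- codim2_strata) stratum_weight w S ^+ 2
  - 2^-1 * \sum_i ((sigma i)%:R - 1) * w i ^+ 2
  - (2 * d%:R)^-1 * (\sum_i w i) ^+ 2.

Record real_PK_arrangement (w : 'I_n -> R) : Prop := RealPKArrangement {
  pk_dim : (2 <= d)%N;
  pk_arr : hyperplane_arrangement;
  pk_weight : forall i, 0 < w i < 1;
  pk_PK1 : \sum_i w i = d%:R;
  pk_PK2 : forall (J : {set 'I_n}) (L : {vspace V}),
    L = (\bigcap_(i in J) H i)%VS -> L != 0%VS -> L != fullv ->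
    \sum_(i | (L <= H i)%VS) w i < d%:R - (\dim L)%:R;
  pk_PK3 : hirzebruch_form w = 0
}.

End Arrangements.
End Defs.

(* Main.v *)
Require Import Defs.
From mathcomp Require Import all_boot all_order all_algebra.
From mathcomp Require Import reals.

(** Condition V1 says that the vectors form a Parseval frame.  Everything is
    obtained by taking traces of this identity, and of its analogue V2 on
    planes.  Let Q be the orthogonal projection onto a subspace U.  If the
    vectors v_i satisfy sum_i (x, v_i)^2 = c |x|^2 for x in U, then the trace of
    this quadratic form on U gives sum_i |Q v_i|^2 = c dim U
    ([sum_sqnorm_proj]).

    For U the whole space and c = 1 this reads sum_i r_i = d, which is PK1.

    For U spanned by some of the alpha_i, so that its orthogonal complement L is
    a flat of the arrangement, the vectors lying in U contribute the sum of
    their r_i, and all the others contribute nonnegative terms.  Hence the sum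
    of the r_i with alpha_i in U is at most dim U = d - dim L, and equality
    would put every other alpha_i in L, which makes the system reducible.  This
    is PK2 ([irreducible_flat_weight_lt]); applied to the flat L = H_i it also
    gives r_i < 1.

    For PK3, a codimension-2 stratum S is the orthogonal complement of a plane U
    containing at least three of the vectors, and V2 on U gives on one hand
    r_S = nu (half the trace), and on the other hand, summing V2 over x = alpha_i
    in U, that the squares (alpha_i, alpha_j)^2 over pairs in U add up to
    2 nu^2.  So r_S^2 is half the sum of these squares
    ([stratum_weight_sqr]).  Summing over S, an off-diagonal pair is counted
    once: the plane it spans either is that of a unique stratum, or contains
    just these two vectors, which are then orthogonal by V3
    ([pair_strata_sum]).  A diagonal pair (i, i) is counted sigma_i times.  As
    V1 gives sum_(i, j) (alpha_i, alpha_j)^2 = sum_i r_i = d, the sum of the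
    r_S^2 is half of sum_i (sigma_i - 1) r_i^2 + d, and the Hirzebruch form
    vanishes because (sum_i r_i)^2 / (2 d) = d / 2. *)

Set Implicit Arguments.
Unset Strict Implicit.
Unset Printing Implicit Defensive.

Import Order.TTheory GRing.Theory Num.Theory.
Local Open Scope ring_scope.

(** * Inner products, orthogonal projections and complements *)

Section EuclideanGeometry.
Variables (R : realType) (d : nat).
Local Notation V := 'rV[R]_d.
Implicit Types (x y a : V) (U W : {vspace V}).

Lemma dotE x y : dot x y = (x *m y^T) 0 0.
Proof. by rewrite mxE; apply: eq_bigr => k _; rewrite mxE. Qed.

Lemma dotC x y : dot x y = dot y x.
Proof. by apply: eq_bigr => k _; rewrite mulrC. Qed.

Lemma dotDl x y a : dot (x + y) a = dot x a + dot y a.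
Proof. by rewrite !dotE mulmxDl mxE. Qed.

Lemma dot0l a : dot 0 a = 0.
Proof. by rewrite dotE mul0mx mxE. Qed.

Lemma sqnorm_ge0 x : 0 <= sqnorm x.
Proof. by apply: sumr_ge0 => k _; rewrite -expr2 sqr_ge0. Qed.

Lemma sqnorm_eq0 x : (sqnorm x == 0) = (x == 0).
Proof.
apply/idP/eqP => [|->]; last by rewrite /sqnorm dot0l.
rewrite psumr_eq0 => [/allP x0|k _]; last by rewrite -expr2 sqr_ge0.
apply/rowP => k; have := x0 k (mem_index_enum k).
by rewrite mulf_eq0 orbb mxE => /eqP.
Qed.

Lemma sqnorm_gt0 x : (0 < sqnorm x) = (x != 0).
Proof. by rewrite lt_def sqnorm_eq0 sqnorm_ge0 andbT. Qed.

Lemma dim_rowspace : \dim (fullv : {vspace V}) = d.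
Proof. by rewrite dimvf /dim /= mul1n. Qed.

(** If v kills B B^T then |v B|^2 = v B B^T v^T = 0, so v B = 0 by positivity of
    the norm, and v = 0. *)
Lemma gram_unitmx m (B : 'M[R]_(m, d)) : row_free B -> B *m B^T \in unitmx.
Proof.
move=> freeB; rewrite -row_free_unit -kermx_eq0; apply/eqP/row_matrixP => i.
rewrite row0; set v := row i _.
have v0 : v *m B *m B^T = 0.
  by rewrite -mulmxA; apply/sub_kermxP; rewrite row_sub.
apply: (row_free_inj freeB); rewrite mul0mx; apply/eqP; rewrite -sqnorm_eq0.
by rewrite /sqnorm dotE trmx_mul mulmxA v0 mul0mx mxE.
Qed.

(** The rows of B being a basis of U, the projection is B^T (B B^T)^-1 B.  This
    formula needs no orthonormal basis, and it makes the trace computable by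
    cyclicity. *)
Lemma orthoproj_exists U : exists Q : 'M[R]_d,
  [/\ Q^T = Q, forall x, x *m Q \in U, forall x, x \in U -> x *m Q = x
    & \tr Q = (\dim U)%:R].
Proof.
pose B : 'M[R]_(\dim U, d) := \matrix_i (vbasis U)`_i.
have mulB (c : 'rV_(\dim U)) : c *m B = \sum_i c 0 i *: (vbasis U)`_i.
  by rewrite mulmx_sum_row; apply: eq_bigr => i _; rewrite rowK.
have freeB : row_free B.
  rewrite -kermx_eq0; apply/eqP/row_matrixP => i; rewrite row0.
  set v := row i _.
  have vB : v *m B = 0 by apply/sub_kermxP; rewrite row_sub.
  have /freeP fb := basis_free (vbasisP U).
  by apply/rowP => j; rewrite [RHS]mxE; apply: (fb (v 0)); rewrite -mulB.
have uG := gram_unitmx freeB.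
set G := B *m B^T in uG.
have symG : G^T = G by rewrite trmx_mul trmxK.
exists (B^T *m invmx G *m B); split.
- by rewrite !trmx_mul trmxK trmx_inv symG mulmxA.
- move=> x; rewrite mulmxA mulB; apply: memv_suml => i _.
  by rewrite memvZ // vbasis_mem // mem_nth // size_tuple.
- move=> x /coord_vbasis defx.
  have {defx} -> : x = (\row_i coord (vbasis U) i x) *m B.
    by rewrite mulB {1}defx; apply: eq_bigr => i _; rewrite mxE.
  by rewrite !mulmxA -(mulmxA _ B) -/G mulmxK.
- by rewrite -mulmxA mxtrace_mulC -mulmxA mulVmx // mxtrace1.
Qed.

Lemma dot_mulmx_sym (Q : 'M[R]_d) x y :
  Q^T = Q -> dot (x *m Q) y = dot x (y *m Q).
Proof. by move=> symQ; rewrite !dotE trmx_mul symQ mulmxA. Qed.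

(** The trace on U of both sides of the frame identity.  Instead of an
    orthonormal basis of U, the identity is summed over the projections of the
    standard basis of the whole space, which are the rows of Q. *)
Lemma sum_sqnorm_proj (I : finType) (P : pred I) (v : I -> V) U (Q : 'M[R]_d)
    (c : R) :
    Q^T = Q -> (forall x, x *m Q \in U) -> (forall x, x \in U -> x *m Q = x) ->
    \tr Q = (\dim U)%:R ->
    (forall x, x \in U -> \sum_(i | P i) dot x (v i) ^+ 2 = c * sqnorm x) ->
  \sum_(i | P i) sqnorm (v i *m Q) = c * (\dim U)%:R.
Proof.
move=> symQ QU Qid trQ frame.
have rowQ k : row k Q \in U by rewrite rowE.
have QQ : Q *m Q = Q by apply/row_matrixP => k; rewrite row_mul Qid.
have coordE i k : (v i *m Q) 0 k = dot (row k Q) (v i).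
  by rewrite -{1}symQ mxE; apply: eq_bigr => j _; rewrite !mxE mulrC.
have sqE i : sqnorm (v i *m Q) = \sum_k dot (row k Q) (v i) ^+ 2.
  by apply: eq_bigr => k _; rewrite coordE.
rewrite (eq_bigr _ (fun i _ => sqE i)) exchange_big /=.
rewrite (eq_bigr _ (fun k _ => frame _ (rowQ k))) -mulr_sumr; congr (_ * _).
rewrite -trQ -{2}QQ -{3}symQ; apply: eq_bigr => k _.
by rewrite /sqnorm /dot mxE; apply: eq_bigr => j _; rewrite !mxE.
Qed.

(** The orthogonal complement, written as an intersection of hyperplanes so that
    the flats of an arrangement are instances of it (see [perp_bigcap]). *)
Definition perp U : {vspace V} :=
  (\bigcap_(i < \dim U) orthv (vbasis U)`_i)%VS.

Lemma mem_bigcap_orthv (I : finType) (P : pred I) (v : I -> V) x :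
  reflect (forall i, P i -> dot x (v i) = 0)
          (x \in (\bigcap_(i | P i) orthv (v i))%VS).
Proof.
rewrite memvE; apply: (iffP subv_bigcapP) => x0 i Pi; have := x0 i Pi.
  by rewrite -memvE mem_orthv => /eqP.
by rewrite -memvE mem_orthv => ->.
Qed.

Lemma memv_orthvC x y : (x \in orthv y) = (y \in orthv x).
Proof. by rewrite !mem_orthv dotC. Qed.

Lemma bigcap_orthv (I : finType) (P : pred I) (v : I -> V) x :
  (x \in (\bigcap_(i | P i) orthv (v i))%VS)
    = ((\sum_(i | P i) <[v i]>)%VS <= orthv x)%VS.
Proof.
apply/mem_bigcap_orthv/subv_sumP => x0 i Pi; have := x0 i Pi.
  by rewrite -memvE memv_orthvC mem_orthv => ->.
by rewrite -memvE memv_orthvC mem_orthv => /eqP.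
Qed.

Lemma mem_perp U x : (x \in perp U) = (U <= orthv x)%VS.
Proof.
rewrite bigcap_orthv; congr (_ <= _)%VS.
by rewrite -[RHS](span_basis (vbasisP U)) span_def big_tuple;
  apply: eq_bigr => i _; rewrite (tnth_nth 0).
Qed.

Lemma perp_bigcap (I : finType) (P : pred I) (v : I -> V) :
  (\bigcap_(i | P i) orthv (v i))%VS = perp (\sum_(i | P i) <[v i]>)%VS.
Proof. by apply/vspaceP => x; rewrite mem_perp bigcap_orthv. Qed.

Lemma mem_perp_proj U (Q : 'M[R]_d) x :
    Q^T = Q -> (forall x, x *m Q \in U) -> (forall x, x \in U -> x *m Q = x) ->
  (x \in perp U) = (x *m Q == 0).
Proof.
move=> symQ QU Qid; rewrite mem_perp.
apply/subvP/eqP => [x0 | xQ u uU].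
  apply/eqP; rewrite -sqnorm_eq0 /sqnorm dot_mulmx_sym // (Qid _ (QU x)).
  by rewrite dotC -mem_orthv x0.
by rewrite mem_orthv -(Qid u uU) dot_mulmx_sym // xQ dotC dot0l.
Qed.

Lemma perp_cap U : (U :&: perp U)%VS = 0%VS.
Proof.
apply/eqP; rewrite -subv0; apply/subvP => x /memv_capP[xU].
by rewrite mem_perp memv0 => /subvP/(_ x xU); rewrite mem_orthv sqnorm_eq0.
Qed.

Lemma perp_add U : (U + perp U)%VS = fullv.
Proof.
have [Q [symQ QU Qid _]] := orthoproj_exists U.
apply/vspaceP => x; rewrite memvf.
rewrite -(subrK (x *m Q) x) addrC memv_add //.
by rewrite (mem_perp_proj _ symQ QU Qid) mulmxBl (Qid _ (QU x)) subrr.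
Qed.

Lemma dim_perp U : (\dim U + \dim (perp U))%N = d.
Proof. by rewrite -dimv_disjoint_sum ?perp_cap // perp_add dim_rowspace. Qed.

(** The double complement of U is U: this turns the incidence of a flat with a
    hyperplane into membership of the normal vector in a subspace. *)
Lemma sub_perp_orthv U a : (perp U <= orthv a)%VS = (a \in U).
Proof.
apply/idP/idP => [sub|aU]; last first.
  apply/subvP => x; rewrite mem_perp memv_orthvC => /subvP; exact.
have /memv_addP[u uU [w wU defa]] : a \in (U + perp U)%VS.
  by rewrite perp_add memvf.
suff w0 : w = 0 by rewrite defa w0 addr0.
apply/eqP; rewrite -sqnorm_eq0 /sqnorm.
have := subvP sub w wU; rewrite mem_orthv defa dotC dotDl => /eqP wa.
have := wU; rewrite mem_perp => /subvP/(_ u uU); rewrite mem_orthv => /eqP uw.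
by rewrite -wa uw add0r.
Qed.

Lemma perp_line a : perp <[a]>%VS = orthv a.
Proof. by apply/vspaceP => x; rewrite mem_perp -memvE memv_orthvC. Qed.

Lemma dim_orthv a : a != 0 -> (\dim (orthv a)).+1 = d.
Proof.
by move=> a0; rewrite -perp_line -[RHS](dim_perp <[a]>%VS) dim_vline a0.
Qed.

Lemma orthv_sub_line a b : (orthv a <= orthv b)%VS -> exists c, b = c *: a.
Proof. by rewrite -perp_line sub_perp_orthv => /vlineP. Qed.

End EuclideanGeometry.

(** * Weights of flats in a Parseval frame *)

Section VeeSystemArrangement.
Variables (R : realType) (d n : nat) (alpha : 'I_n -> 'rV[R]_d).
Local Notation V := 'rV[R]_d.
Local Notation H := (fun i : 'I_n => orthv (alpha i)).
Local Notation r := (fun i : 'I_n => sqnorm (alpha i)).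
Implicit Types (x : V) (U S : {vspace V}).

Lemma frame_weight U (c : R) :
    (forall x, x \in U ->
       \sum_(i | alpha i \in U) dot x (alpha i) ^+ 2 = c * sqnorm x) ->
  \sum_(i | alpha i \in U) sqnorm (alpha i) = c * (\dim U)%:R.
Proof.
have [Q [symQ QU Qid trQ]] := orthoproj_exists U.
move=> /(sum_sqnorm_proj symQ QU Qid trQ) <-.
by apply: eq_bigr => i iU; rewrite Qid.
Qed.

Hypothesis parseval : forall x, \sum_i dot x (alpha i) ^+ 2 = sqnorm x.

Lemma total_weight : \sum_i sqnorm (alpha i) = d%:R.
Proof.
rewrite -[X in X%:R](dim_rowspace R d) -[RHS]mul1r -frame_weight => [|x _].
  by apply: eq_bigl => i; rewrite memvf.
by rewrite mul1r -parseval; apply: eq_bigl => i; rewrite memvf.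
Qed.

Lemma sum_dot_sqr : \sum_i \sum_j dot (alpha i) (alpha j) ^+ 2 = d%:R.
Proof. by rewrite -total_weight; apply: eq_bigr => i _; rewrite parseval. Qed.

(** The squared lengths of the projections to U of all vectors add up to dim U,
    and the vectors of U account for their full squared length.  If these alone
    reach dim U, then every other vector projects to 0, that is, lies in the
    complement of U, and the system splits. *)
Lemma irreducible_weight_lt U :
    irreducible_system alpha -> U != 0%VS -> perp U != 0%VS ->
  \sum_(i | alpha i \in U) sqnorm (alpha i) < (\dim U)%:R.
Proof.
move=> irr U0 U'0; rewrite ltNge; apply/negP => geU.
have [Q [symQ QU Qid trQ]] := orthoproj_exists U.
have := @sum_sqnorm_proj R d _ predT alpha U Q 1 symQ QU Qid trQ.
rewrite mul1r (bigID (fun i => alpha i \in U)) /= => sumQ.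
have {sumQ} sumQ: \sum_(i | alpha i \notin U) sqnorm (alpha i *m Q) = 0.
  apply/eqP; rewrite eq_le sumr_ge0 => [|i _]; last exact: sqnorm_ge0.
  rewrite andbT -(lerD2l (\sum_(i | alpha i \in U) sqnorm (alpha i *m Q))).
  rewrite sumQ => [|x _]; last by rewrite mul1r.
  rewrite addr0 (le_trans geU) // le_eqVlt; apply/orP; left; apply/eqP.
  by apply: eq_bigr => i iU; rewrite Qid.
case: irr; exists U, (perp U); split=> //.
- exact: perp_add.
- exact: perp_cap.
move=> i; have [//|iU] := boolP (alpha i \in U); rewrite /=.
rewrite (mem_perp_proj _ symQ QU Qid) -sqnorm_eq0.
have := psumr_eq0P (fun j _ => sqnorm_ge0 (alpha j *m Q)) sumQ iU.
by move->.
Qed.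

Lemma irreducible_flat_weight_lt (J : {set 'I_n}) L :
    irreducible_system alpha ->
    L = (\bigcap_(i in J) H i)%VS -> L != 0%VS -> L != fullv ->
  \sum_(i | (L <= H i)%VS) r i < d%:R - (\dim L)%:R.
Proof.
move=> irr; rewrite perp_bigcap; set U := (\sum_(i in J) _)%VS => -> L0 LT.
have -> : d%:R - (\dim (perp U))%:R = (\dim U)%:R :> R.
  by rewrite -[X in X%:R - _](dim_perp U) natrD addrK.
rewrite (eq_bigl _ _ (fun i => sub_perp_orthv U (alpha i))).
apply: irreducible_weight_lt => //; apply: contraNneq LT => U0.
by rewrite -(perp_add U) U0 add0v.
Qed.

End VeeSystemArrangement.

(** * Vanishing of the Hirzebruch quadratic form *)

Section HirzebruchForm.
Variables (R : realType) (d n : nat) (alpha : 'I_n -> 'rV[R]_d).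
Hypothesis vee : euclidean_vee_system alpha.
Local Notation V := 'rV[R]_d.
Local Notation H := (fun i : 'I_n => orthv (alpha i)).
Local Notation r := (fun i : 'I_n => sqnorm (alpha i)).
Implicit Types (U S : {vspace V}).

Lemma stratum_plane S : S \in codim2_strata H ->
  exists U, [/\ S = perp U, \dim U = 2%N & (3 <= #|[set i | alpha i \in U]|)%N].
Proof.
case/mem_codim2_strata => dS [J J3 defS]; rewrite perp_bigcap in defS.
exists (\sum_(i in J) <[alpha i]>)%VS; split=> //.
  apply/eqP; rewrite -(eqn_add2r (\dim S)) {1}defS.
  by rewrite dim_perp; apply/eqP/esym.
apply: leq_trans J3 (subset_leq_card _); apply/subsetP => i iJ.
by rewrite inE memvE (sumv_sup i).
Qed.

Lemma dim_pair_span i j : i != j -> \dim (<[alpha i]> + <[alpha j]>)%VS = 2%N.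
Proof.
move=> neq_ij; have ne0 := vee_neq0 vee.
rewrite dimv_disjoint_sum ?dim_vline ?ne0 //.
apply/eqP; rewrite -subv0; apply/subvP => x /memv_capP[/vlineP[a ->]].
have [->|a0] := eqVneq a 0; first by rewrite scale0r memv0.
case/vlineP=> b defb; case: (vee_nonprop vee neq_ij (c := a^-1 * b)).
by rewrite -scalerA -defb scalerA mulVf // scale1r.
Qed.

(** With nu given by V2 on the plane U orthogonal to S, the weights in U add up
    to 2 nu by the trace formula; so the left-hand side is nu^2, and on the right
    the inner sums are nu r_i, which add up to nu (2 nu). *)
Lemma stratum_weight_sqr S : S \in codim2_strata H ->
  stratum_weight H r S ^+ 2 =
    2^-1 * \sum_(i | (S <= H i)%VS) \sum_(j | (S <= H j)%VS)
             dot (alpha i) (alpha j) ^+ 2.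
Proof.
case/stratum_plane=> U [-> dU /(vee_V2 vee dU)[nu nuE]].
have memS := fun i => sub_perp_orthv U (alpha i).
have trU := frame_weight nuE; rewrite dU in trU.
rewrite /stratum_weight !(eq_bigl _ _ memS) trU.
under eq_bigr => i iU do rewrite (eq_bigl _ _ memS) nuE //.
have half : 2^-1 * (nu * 2) = nu by rewrite mulrC mulfK ?pnatr_eq0.
by rewrite -mulr_sumr trU half mulrCA half expr2.
Qed.

(** At most one stratum lies in both hyperplanes, namely the complement of the
    plane U spanned by the pair.  If it is not a stratum, then U contains no third
    vector and V3 makes both sides zero. *)
Lemma pair_strata_sum i j : i != j ->
  \sum_(S <- codim2_strata H | (S <= H i)%VS && (S <= H j)%VS)
     dot (alpha i) (alpha j) ^+ 2 = dot (alpha i) (alpha j) ^+ 2.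
Proof.
move=> neq_ij; set U := (<[alpha i]> + <[alpha j]>)%VS.
have dU : \dim U = 2%N := dim_pair_span neq_ij.
have iU : alpha i \in U by rewrite memvE addvSl.
have jU : alpha j \in U by rewrite memvE addvSr.
have only S : S \in codim2_strata H ->
    (S <= H i)%VS && (S <= H j)%VS = (S == perp U).
  case/stratum_plane=> W [-> dW _]; apply/andP/eqP => [[]|->].
    rewrite !sub_perp_orthv => iW jW; congr perp; apply/esym/eqP.
    by rewrite eqEdim dW dU leqnn andbT subv_add -!memvE iW.
  by rewrite !sub_perp_orthv.
(* Restrict to strata, where the condition can be replaced by S == perp U. *)
rewrite big_seq_cond.
rewrite (eq_bigl (fun S => (S \in codim2_strata H) && (S == perp U)));
  last first.
  by move=> S; have [/only|] := boolP (S \in _).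
rewrite -big_seq_cond.
have [inG|notinG] := boolP (perp U \in codim2_strata H).
  by rewrite -big_filter filter_pred1_uniq ?undup_uniq // big_seq1.
rewrite big_hasC; last by apply: contra notinG => /hasP[S SG /eqP <-].
have sub2 : [set i; j] \subset [set k | alpha k \in U].
  by apply/subsetP => k; rewrite !inE => /orP[]/eqP->.
rewrite (vee_V3 vee dU neq_ij) ?expr0n //; apply/esym/eqP.
rewrite eqEcard sub2 cards2 neq_ij leqNgt; apply: contra notinG => U3.
apply/mem_codim2_strata; split; first by have := dim_perp U; rewrite dU.
exists [set k | alpha k \in U] => //; rewrite perp_bigcap; congr perp.
apply/eqP; rewrite eqEsubv; apply/andP; split.
  by rewrite subv_add (sumv_sup i) ?(sumv_sup j) ?inE.
by apply/subv_sumP => k; rewrite inE memvE.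
Qed.

(** Exchanging the sums, a pair (i, j) occurs once for each stratum contained in
    both hyperplanes: sigma_i times if i = j, and in effect once otherwise. *)
Lemma sum_stratum_weight_sqr :
  \sum_(S <- codim2_strata H) stratum_weight H r S ^+ 2 =
    2^-1 * (\sum_i ((sigma H i)%:R - 1) * r i ^+ 2 + d%:R).
Proof.
rewrite big_seq (eq_bigr _ stratum_weight_sqr) -big_seq -mulr_sumr.
congr (_ * _); rewrite -(sum_dot_sqr (vee_V1 vee)) -big_split /=.
under eq_bigr => S _ do rewrite big_mkcond /=.
rewrite exchange_big /=; apply: eq_bigr => i _.
rewrite -big_mkcond /=.
under eq_bigr => S _ do rewrite big_mkcond /=.
rewrite exchange_big /= (bigD1 i) //= [in RHS](bigD1 i) //= addrA.
congr (_ + _); last first.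
  apply: eq_bigr => j; rewrite eq_sym => neq_ij.
  by rewrite -big_mkcondr pair_strata_sum.
rewrite mulrBl mul1r subrK -big_mkcondr /=.
rewrite big_const_seq iter_addr_0 mulr_natl; congr (_ *+ _).
by apply: eq_count => S; rewrite andbb.
Qed.

Lemma hirzebruch_form_vee : (0 < d)%N -> hirzebruch_form H r = 0.
Proof.
move=> d0; have dR : d%:R != 0 :> R by rewrite pnatr_eq0 -lt0n.
rewrite /hirzebruch_form sum_stratum_weight_sqr (total_weight (vee_V1 vee)).
rewrite mulrDr [X in X - _]addrAC subrr add0r.
by rewrite invfM expr2 mulrA mulfVK // subrr.
Qed.

End HirzebruchForm.

(** * The real PK arrangement of a vee-system *)

Theorem theorem1p1 (R : realType) (d n : nat) (hd : (2 <= d)%N)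
    (alpha : 'I_n -> 'rV[R]_d)
    (hvee : euclidean_vee_system alpha) (hirr : irreducible_system alpha) :
  real_PK_arrangement (fun i : 'I_n => orthv (alpha i))
                      (fun i : 'I_n => sqnorm (alpha i)).
Proof.
have ne0 := vee_neq0 hvee; have V1 := vee_V1 hvee.
have flat := irreducible_flat_weight_lt V1 hirr.
split=> //.
- split=> [i|i j /= eqH]; first exact: dim_orthv.
  apply/eqP/negPn/negP => neq_ij.
  have [c defi] : exists c, alpha i = c *: alpha j.
    by apply: orthv_sub_line; rewrite -eqH.
  exact: (vee_nonprop hvee neq_ij defi).
- move=> i; rewrite sqnorm_gt0 ne0 /=.
  have dimH := dim_orthv (ne0 i).
  have H0 : orthv (alpha i) != 0%VS by rewrite -dimv_eq0 -lt0n -ltnS dimH.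
  have HT : orthv (alpha i) != fullv.
    by apply: contra_eq_neq dimH => ->; rewrite dim_rowspace eqn_leq ltnn.
  (* The flat H_i has dimension d - 1, and r_i is one of the weights it bounds. *)
  have := flat _ _ (esym (big_set1 _ _ _)) H0 HT.
  rewrite -[X in X%:R - _]dimH -natr1 addrAC subrr add0r; apply: le_lt_trans.
  rewrite (bigD1 i) //= lerDl; apply: sumr_ge0 => j _; exact: sqnorm_ge0.
- exact: total_weight.
- by apply: hirzebruch_form_vee => //; apply: ltnW.
Qed.
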